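(* The following decision problem is poset-isomorphism complete: given two finite posets $\mathcal P$ and $\mathcal Q$, decide whether $\mathcal P$ is rotation-equivalent to some poset isomorphic to $\mathcal Q$. That is, this problem and the problem of deciding whether two given finite posets are isomorphic are polynomial-time reducible to each other.
   Context: For a poset $(P,\leq)$: $x<y$ means $x\le y$, $x\ne y$; $x\perp y$ means $x,y$ incomparable; $X<Y$ for sets means $x<y$ for all $x\in X,y\in Y$. A downset is $X$ with $y<x\in X\Rightarrow y\in X$; an up-set dually. If $A,C\subseteq P$ are disjoint, $A$ is a downset, $C$ is an up-set and $A<C$, and $B:=P\setminus(A\cup C)$, then the rotation $\mathfrak R_{A,C}(P,\leq)$ is $(P,\preceq)$ with $x\preceq y$ iff: (i) $x,y$ both in $A$, both in $B$ or both in $C$, and $x\le y$; or (ii) $x\in B$, $y\in A$, $x\perp y$; or (iii) $x\in C$, $y\in A$; or (iv) $x\in C$, $y\in B$, $x\perp y$. Two posets on the same set are rotation-equivalent if one can be transformed into the other by a finite sequence of rotations (each rotation applied to the current poset). *)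

(* Defs.v *)
From HB Require Import structures.
From mathcomp Require Import all_boot all_order all_algebra.

Set Implicit Arguments.
Unset Strict Implicit.
Unset Printing Implicit Defensive.

Local Open Scope nat_scope.

(** * Posets and rotations *)

Record poset (T : finType) := Poset {
  le :> rel T;
  le_refl : reflexive le;
  le_anti : antisymmetric le;
  le_trans : transitive le
}.

Section Rotation.
Variable T : finType.
Implicit Types (r : rel T) (A C X Y : {set T}).

Definition lt_of r : rel T := fun x y => (x != y) && r x y.
Definition incomp r : rel T := fun x y => ~~ r x y && ~~ r y x.

Definition downset r X := forall x y, x \in X -> lt_of r y x -> y \in X.
Definition upset r X := forall x y, x \in X -> lt_of r x y -> y \in X.
Definition set_lt r X Y := forall x y, x \in X -> y \in Y -> lt_of r x y.

Definition rotatable r A C : Prop :=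
  [/\ [disjoint A & C], downset r A, upset r C & set_lt r A C].

Definition rotation A C r : rel T := fun x y =>
  let B := ~: (A :|: C) in
  [|| [|| (x \in A) && (y \in A), (x \in B) && (y \in B)
        | (x \in C) && (y \in C)] && r x y,
      [&& x \in B, y \in A & incomp r x y],
      (x \in C) && (y \in A)
    | [&& x \in C, y \in B & incomp r x y]].

(* Relations are compared extensionally.  Rotations preserve partial orders,
   so every relation reached from a poset is again a poset. *)
Inductive rotates_to : rel T -> rel T -> Prop :=
| rotates_to_refl r r' : r =2 r' -> rotates_to r r'
| rotates_to_step r r' A C :
    rotatable r A C -> rotates_to (rotation A C r) r' -> rotates_to r r'.

Definition rotation_equivalent (P P' : poset T) : Prop := rotates_to P P'.

End Rotation.

Definition poset_isomorphic (T U : finType) (P : poset T) (Q : poset U) : Prop :=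
  exists2 f : T -> U, bijective f & forall x y, P x y = Q (f x) (f y).

(** * Turing machines *)

(* [None] is the blank and [Some (inl b)] an input/output bit; [S] consists of
   the auxiliary work symbols. *)
Definition cell (S : finType) : finType := option (bool + S)%type.

Inductive move := MoveLeft | MoveStay | MoveRight.

Definition move_head (m : move) (i : int) : int :=
  match m with
  | MoveLeft => (i - 1)%R
  | MoveStay => i
  | MoveRight => (i + 1)%R
  end.

(* A deterministic machine with [tm_ntapes.+1] two-way infinite tapes. *)
Record turing_machine := TuringMachine {
  tm_state : finType;
  tm_sym : finType;
  tm_ntapes : nat;
  tm_start : tm_state;
  tm_halt : pred tm_state;
  tm_delta : tm_state -> {ffun 'I_tm_ntapes.+1 -> cell tm_sym} ->
    tm_state * ('I_tm_ntapes.+1 -> cell tm_sym * move)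
}.

Definition tape_of_word (S : finType) (w : seq bool) (i : int) : cell S :=
  match i with
  | Posz n => nth None [seq Some (inl b) | b <- w] n
  | Negz _ => None
  end.

Section Run.
Variable M : turing_machine.
Local Notation tape_idx := 'I_(tm_ntapes M).+1.

Record config := Config {
  c_state : tm_state M;
  c_head : tape_idx -> int;
  c_tape : tape_idx -> int -> cell (tm_sym M)
}.

Definition tm_init (w : seq bool) : config :=
  Config (tm_start M) (fun=> 0%R)
    (fun k => if k == ord0 then @tape_of_word (tm_sym M) w else fun=> None).

Definition tm_step (c : config) : config :=
  if tm_halt (c_state c) then c else
  let: (q, act) :=
    tm_delta (c_state c) [ffun k => c_tape c k (c_head c k)] in
  Config q (fun k => move_head (act k).2 (c_head c k))
    (fun k i => if i == c_head c k then (act k).1 else c_tape c k i).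

(* The output is read on the last tape, which must be blank elsewhere. *)
Definition tm_computes_within (t : nat) (w w' : seq bool) : Prop :=
  let c := iter t tm_step (tm_init w) in
  tm_halt (c_state c) /\ c_tape c ord_max =1 @tape_of_word (tm_sym M) w'.

End Run.

(** * Decision problems and polynomial-time many-one reductions *)

Record decision_problem := DecisionProblem {
  instance : Type;
  encode : instance -> seq bool;
  yes_instance : instance -> Prop
}.

Definition polytime_computable (I J : Type) (encI : I -> seq bool)
    (encJ : J -> seq bool) (f : I -> J) : Prop :=
  exists (M : turing_machine) (p : {poly nat}), forall x : I,
    tm_computes_within M p.[size (encI x)]%R (encI x) (encJ (f x)).

Definition polytime_reducible (D E : decision_problem) : Prop :=
  exists2 f : instance D -> instance E,
    polytime_computable (@encode D) (@encode E) f
    & forall x, yes_instance x <-> yes_instance (f x).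

(** * The two problems *)

Record finite_poset := FinitePoset {
  fp_size : nat;
  fp_order :> poset 'I_fp_size
}.

(* The size in unary, a separator, and the order matrix row by row; this code
   is self-delimiting, so pairs are encoded by concatenation. *)
Definition encode_poset (P : finite_poset) : seq bool :=
  nseq (fp_size P) true ++
  false :: [seq P x y | x <- enum 'I_(fp_size P), y <- enum 'I_(fp_size P)].

Definition encode_poset_pair (PQ : finite_poset * finite_poset) : seq bool :=
  encode_poset PQ.1 ++ encode_poset PQ.2.

Definition poset_isomorphism_problem : decision_problem :=
  @DecisionProblem (finite_poset * finite_poset)%type encode_poset_pair
    (fun PQ => poset_isomorphic PQ.1 PQ.2).

Definition rotation_isomorphism_problem : decision_problem :=
  @DecisionProblem (finite_poset * finite_poset)%type encode_poset_pair
    (fun PQ => exists2 R : poset 'I_(fp_size PQ.1),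
       rotation_equivalent PQ.1 R & poset_isomorphic R PQ.2).

(* Main.v *)
(* Give an ordered pair of points the weight w(x, y) = -1, 0 or 1 according as
   x < y, x and y are incomparable, or x > y.  The rotation R_{A,C} adds to w
   the coboundary f(x) - f(y) of f = 1_A - 1_C, so the curl
   w(x, y) + w(y, z) + w(z, x) is invariant.  Conversely, rotating P at the
   principal downset of v and the set of points above v makes v the top element
   and yields a poset P_v that depends on v and the curl only; as rotations are
   invertible, two posets are rotation-equivalent iff they have the same curl.

   To reduce rotation equivalence to isomorphism, map P to the disjoint union of
   the P_v: its maximal elements are the points v of P_v, so an isomorphism
   between two such unions restricts to P_v = Q_u for some v and u.  To reduce
   isomorphism to rotation equivalence, add |P|^2 - |P| isolated points to P: a
   curl-preserving bijection then sends some isolated point to an isolated one,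
   hence is an isomorphism, and isolated points can be cancelled.

   Both constructions put on the pairs of points an order defined by a
   quantifier-free formula in the order of P.  Such a formula is evaluated on
   all pairs of pairs by a program on counters with four nested loops, where a
   counter is the head position on a tape of a Turing machine. *)
From mathcomp Require Import all_boot all_order all_algebra zify.
From Stdlib Require Import FunctionalExtensionality.
Require Import Defs.

Set Implicit Arguments.
Unset Strict Implicit.
Unset Printing Implicit Defensive.

Import Order.TTheory GRing.Theory Num.Theory.
Local Open Scope nat_scope.

(** * Counter programs *)

Inductive atom :=
  Inc of nat | Dec of nat | NonZero of nat | ReadBit | Out of bool | Skip of bool.

(* The counters and the output written so far. *)
Definition mem := ((nat -> nat) * seq bool)%type.

Definition upd (r : nat -> nat) k x : nat -> nat :=
  fun j => if j == k then x else r j.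

Definition atom_exit (w : seq bool) (a : atom) (s : mem) : bool :=
  match a with
  | NonZero k => s.1 k != 0
  | ReadBit => nth false w (s.1 0)
  | Skip b => b
  | _ => true
  end.

Definition atom_apply (a : atom) (s : mem) : mem :=
  match a with
  | Inc k => (upd s.1 k (s.1 k).+1, s.2)
  | Dec k => (upd s.1 k (s.1 k).-1, s.2)
  | Out b => (s.1, rcons s.2 b)
  | _ => s
  end.

(* Every program exits with a boolean, which [Seq] ignores in its first
   component, and which [Ite] and [While] test in theirs. *)
Inductive prog :=
| Atom of atom
| Seq of prog & prog
| Ite of prog & prog & prog
| While of prog & prog.

(* The control states of a program are the occurrences of atoms in it. *)
Fixpoint point (p : prog) : finType :=
  match p with
  | Atom _ => unit
  | Seq p q => (point p + point q)%type
  | Ite p q r => (point p + (point q + point r))%type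
  | While p q => (point p + point q)%type
  end.

Fixpoint entry (p : prog) : point p :=
  match p with
  | Atom _ => tt
  | Seq p _ => inl (entry p)
  | Ite p _ _ => inl (entry p)
  | While p _ => inl (entry p)
  end.

Fixpoint atom_at (p : prog) : point p -> atom :=
  match p return point p -> atom with
  | Atom a => fun _ => a
  | Seq p q => fun x =>
      match x with inl y => atom_at y | inr y => atom_at y end
  | Ite p q r => fun x =>
      match x with
      | inl y => atom_at y
      | inr (inl y) => atom_at y
      | inr (inr y) => atom_at y
      end
  | While p q => fun x =>
      match x with inl y => atom_at y | inr y => atom_at y end
  end.

Definition goto_or (A B : Type) (f : A -> B) (g : bool -> B + bool)
    (x : A + bool) : B + bool :=
  match x with inl y => inl (f y) | inr b => g b end.

Fixpoint next (p : prog) : point p -> bool -> point p + bool :=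
  match p return point p -> bool -> (point p + bool)%type with
  | Atom _ => fun _ b => inr b
  | Seq p q => fun x b =>
      match x with
      | inl y => goto_or inl (fun=> inl (inr (entry q))) (next y b)
      | inr y => goto_or inr inr (next y b)
      end
  | Ite p q r => fun x b =>
      match x with
      | inl y => goto_or inl (fun b => inl (inr
          (if b then inl (entry q) else inr (entry r)))) (next y b)
      | inr (inl y) => goto_or (fun z => inr (inl z)) inr (next y b)
      | inr (inr y) => goto_or (fun z => inr (inr z)) inr (next y b)
      end
  | While p q => fun x b =>
      match x with
      | inl y => goto_or inl
          (fun b => if b then inl (inr (entry q)) else inr false) (next y b)
      | inr y => goto_or inr (fun=> inl (inl (entry p))) (next y b)
      end
  end.

Section Semantics.
Variable w : seq bool.

Inductive reach (p : prog) : nat -> point p -> mem -> bool -> mem -> Prop :=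
| reach_exit x s b :
    next x (atom_exit w (atom_at x) s) = inr b ->
    reach 1 x s b (atom_apply (atom_at x) s)
| reach_step t x y s b s' :
    next x (atom_exit w (atom_at x) s) = inl y ->
    reach t y (atom_apply (atom_at x) s) b s' -> reach t.+1 x s b s'.

Definition runs p s b s' c := exists2 t, t <= c & reach t (entry p) s b s'.

Lemma runs_weaken c p s b s' c' :
  runs p s b s' c -> c <= c' -> runs p s b s' c'.
Proof. by move=> [t lt_tc rt] le_cc'; exists t => //; apply: leq_trans le_cc'. Qed.

Lemma runs_atom a s : runs (Atom a) s (atom_exit w a s) (atom_apply a s) 1.
Proof. by exists 1 => //; apply: (@reach_exit (Atom a)). Qed.

(* [g] embeds the control points of [p] into those of [q] up to an exit of
   [p], which makes [q] continue at [k b]. *)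
Lemma reach_embed p q (g : point p -> point q) (k : bool -> point q + bool) :
  (forall x, atom_at (g x) = atom_at x) ->
  (forall x b, next (g x) b = goto_or g k (next x b)) ->
  forall t x s b s', reach t x s b s' ->
    match k b with
    | inl y => forall t' b' s'', reach t' y s' b' s'' ->
        reach (t + t') (g x) s b' s''
    | inr b' => reach t (g x) s b' s'
    end.
Proof.
move=> ga gn t x s b s'; elim=> {t x s b s'} [x s b|t x y s b s'] nx.
  case kb: (k b) => [y|b'].
    move=> t' b' s'' ry; rewrite add1n; apply: (@reach_step _ _ _ y).
      by rewrite ga gn nx /= kb.
    by rewrite ga.
  by rewrite -ga; apply: reach_exit; rewrite ga gn nx /= kb.
move=> _; case: (k b) => [z|b'] IH.
  move=> t' b' s'' rz; rewrite addSn; apply: (@reach_step _ _ _ (g y)).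
    by rewrite ga gn nx.
  by rewrite ga; apply: IH.
by apply: (@reach_step _ _ _ (g y)); rewrite ga // gn nx.
Qed.

Lemma runs_seq p q s b s1 c1 b' s' c2 :
  runs p s b s1 c1 -> runs q s1 b' s' c2 -> runs (Seq p q) s b' s' (c1 + c2).
Proof.
move=> [t1 le1 r1] [t2 le2 r2]; exists (t1 + t2); first exact: leq_add.
have := @reach_embed p (Seq p q) inl (fun=> inl (inr (entry q))) _ _ _ _ _ _ _ r1.
apply=> //.
exact: (@reach_embed q (Seq p q) inr inr _ _ _ _ _ _ _ r2).
Qed.

Lemma runs_ite p q r s b s1 c1 b' s' c2 :
  runs p s b s1 c1 -> runs (if b then q else r) s1 b' s' c2 ->
  runs (Ite p q r) s b' s' (c1 + c2).
Proof.
move=> [t1 le1 r1] [t2 le2 r2]; exists (t1 + t2); first exact: leq_add.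
have := @reach_embed p (Ite p q r) inl (fun b => inl (inr
  (if b then inl (entry q) else inr (entry r)))) _ _ _ _ _ _ _ r1.
apply=> // {r1}; case: b r2 => r2.
  exact: (@reach_embed q (Ite p q r) (fun z => inr (inl z)) inr _ _ _ _ _ _ _ r2).
exact: (@reach_embed r (Ite p q r) (fun z => inr (inr z)) inr _ _ _ _ _ _ _ r2).
Qed.

Lemma runs_while_stop p q s s' c :
  runs p s false s' c -> runs (While p q) s false s' c.
Proof.
move=> [t le_tc r]; exists t => //.
exact: (@reach_embed p (While p q) inl
  (fun b => if b then inl (inr (entry q)) else inr false) _ _ _ _ _ _ _ r).
Qed.

Lemma runs_while_loop p q s s1 c1 b s2 c2 b' s' c3 :
  runs p s true s1 c1 -> runs q s1 b s2 c2 -> runs (While p q) s2 b' s' c3 ->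
  runs (While p q) s b' s' (c1 + c2 + c3).
Proof.
move=> [t1 le1 r1] [t2 le2 r2] [t3 le3 r3].
exists (t1 + (t2 + t3)); first by rewrite addnA !leq_add.
have := @reach_embed p (While p q) inl
  (fun b => if b then inl (inr (entry q)) else inr false) _ _ _ _ _ _ _ r1.
apply=> //.
have := @reach_embed q (While p q) inr (fun=> inl (inl (entry p))) _ _ _ _ _ _ _ r2.
exact.
Qed.

Lemma runs_while p q (S : nat -> mem) n c :
  (forall i, i < n -> runs p (S i) true (S i) 1) ->
  (forall i, i < n -> exists b, runs q (S i) b (S i.+1) c) ->
  runs p (S n) false (S n) 1 ->
  runs (While p q) (S 0) false (S n) (n * c.+1 + 1).
Proof.
elim: n S => [|n IH] S test body stop; first exact: runs_while_stop.
have [b rb] := body 0 isT.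
apply: runs_weaken (runs_while_loop (test 0 isT) rb
  (IH (fun i => S i.+1) _ _ stop)) _ => [i|i|].
- exact: (test i.+1).
- exact: (body i.+1).
by rewrite mulSn; lia.
Qed.

End Semantics.

(** * Simulation by a Turing machine *)

Section Machine.
Variables (K : nat) (p : prog).

Local Notation cell := (cell bool).

(* Counter [k] is the position of the head of tape [k]; its origin carries a
   marked symbol [inr b].  Tape [0] is the input tape, and [inr b] stands there
   for the input bit [b]; tape [K] is the output tape. *)
Definition marked (c : cell) := if c is Some (inr _) then true else false.
Definition bit (c : cell) :=
  match c with Some (inl b) => b | Some (inr b) => b | None => false end.

Definition machine_exit (a : atom) (c : {ffun 'I_K.+1 -> cell}) : bool :=
  match a with
  | NonZero k => ~~ marked (c (inord k))
  | ReadBit => bit (c ord0)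
  | Skip b => b
  | _ => true
  end.

Definition machine_action (a : atom) (c : {ffun 'I_K.+1 -> cell})
    (j : 'I_K.+1) : cell * move :=
  match a with
  | Inc k => (c j, if j == k :> nat then MoveRight else MoveStay)
  | Dec k =>
      (c j, if (j == k :> nat) && ~~ marked (c j) then MoveLeft else MoveStay)
  | Out b =>
      if j == ord_max then (Some (inl b), MoveRight) else (c j, MoveStay)
  | _ => (c j, MoveStay)
  end.

(* The initial state [None] marks the origins. *)
Definition machine : turing_machine :=
  @TuringMachine (option (point p + bool)) bool K None
    (fun q => if q is Some (inr _) then true else false)
    (fun q c =>
       match q with
       | None => (Some (inl (entry p)), fun j =>
           (if j == ord_max then c j else Some (inr (bit (c j))), MoveStay))
       | Some (inl x) => (Some (next x (machine_exit (atom_at x) c)),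
           machine_action (atom_at x) c)
       | Some (inr b) => (q, fun j => (c j, MoveStay))
       end).

Definition atom_ok (a : atom) :=
  match a with Inc k | Dec k | NonZero k => k < K | _ => true end.

Fixpoint prog_ok (q : prog) :=
  match q with
  | Atom a => atom_ok a
  | Seq q1 q2 => prog_ok q1 && prog_ok q2
  | Ite q1 q2 q3 => [&& prog_ok q1, prog_ok q2 & prog_ok q3]
  | While q1 q2 => prog_ok q1 && prog_ok q2
  end.

Lemma atom_at_ok (q : prog) (x : point q) : prog_ok q -> atom_ok (atom_at x).
Proof.
elim: q x => [a|q1 IH1 q2 IH2|q1 IH1 q2 IH2 q3 IH3|q1 IH1 q2 IH2] x //=.
- by case: x => y /andP[/IH1 + /IH2].
- by case: x => [y|[y|y]] /and3P[/IH1 + /IH2 + /IH3].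
- by case: x => y /andP[/IH1 + /IH2].
Qed.

Variable w : seq bool.
Hypotheses (K_gt0 : 0 < K) (p_ok : prog_ok p).

Definition counter_tape (j : nat) (i : int) : cell :=
  if i == 0%R then Some (inr ((j == 0) && nth false w 0))
  else if j == 0 then tape_of_word bool w i else None.

Definition represents (c : config machine) (q : point p + bool) (s : mem) :=
  [/\ c_state c = Some q,
      forall j : 'I_K.+1, j < K -> c_head c j = Posz (s.1 j),
      forall j : 'I_K.+1, j < K -> c_tape c j =1 counter_tape j,
      c_head c ord_max = Posz (size s.2)
    & c_tape c ord_max =1 tape_of_word bool s.2].

Lemma marked_counter (j i : nat) : marked (counter_tape j (Posz i)) = (i == 0).
Proof.
case: i => [|i]; rewrite /counter_tape //=.
case: (j == 0) => //=; case: w => //= _ v.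
by elim: v i => [|b v IH] [|i] //=; apply: IH.
Qed.

Lemma bit_counter (i : nat) : bit (counter_tape 0 (Posz i)) = nth false w i.
Proof.
case: i => [|i]; rewrite /counter_tape //=.
case: w => //= _ v.
by elim: v i => [|b v IH] [|i] //=; apply: IH.
Qed.

Lemma tape_of_word_rcons (v : seq bool) b (i : int) :
  tape_of_word bool (rcons v b) i =
  if i == Posz (size v) then Some (inl b) else tape_of_word bool v i.
Proof.
case: i => [i|//] /=; rewrite map_rcons nth_rcons size_map eqz_nat.
by case: ltngtP => // lt; rewrite nth_default // size_map ltnW.
Qed.

Lemma lt_ord_max (j : 'I_K.+1) : (j < K) = (j != ord_max).
Proof. by rewrite -val_eqE /= ltn_neqAle -ltnS ltn_ord andbT. Qed.

Lemma represents_step c x s : represents c (inl x) s ->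
  represents (tm_step c) (next x (atom_exit w (atom_at x) s))
    (atom_apply (atom_at x) s).
Proof.
case=> st hd tp ohd otp; rewrite /tm_step st /=.
set c' := [ffun k => _].
have c'E (j : 'I_K.+1) : j < K -> c' j = counter_tape j (Posz (s.1 j)).
  by move=> lt; rewrite ffunE tp // hd.
have ok := atom_at_ok x p_ok.
have exitE : machine_exit (atom_at x) c' = atom_exit w (atom_at x) s.
  case: (atom_at x) ok => //= [k lt_kK|_].
    by rewrite c'E inordK ?ltnS // ?marked_counter // ltnW.
  by rewrite c'E //= bit_counter.
rewrite exitE; split=> //=.
- move=> j lt_jK; rewrite hd //; case: (atom_at x) ok => //= k lt_kK.
  + rewrite /upd; case: eqP => [->|//] /=; lia.
  + rewrite /upd c'E // marked_counter; case: eqP => [->|//] /=.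
    by case: (s.1 k) => [|m] //=; lia.
  + by rewrite lt_ord_max in lt_jK; rewrite (negPf lt_jK).
- move=> j lt_jK i.
  have neq : (j == ord_max) = false by apply/negbTE; rewrite -lt_ord_max.
  have -> : (machine_action (atom_at x) c' j).1 = c' j.
    by case: (atom_at x) => //= b; rewrite neq.
  by case: eqP => [->|_]; rewrite ?tp ?c'E ?hd.
- rewrite ohd; case: (atom_at x) ok => //= [k|k|b]; last first.
  + by rewrite eqxx size_rcons /=; lia.
  + by move=> lt_kK; rewrite [K == k]gtn_eqF.
  + by move=> lt_kK; rewrite [K == k]gtn_eqF.
- move=> i; rewrite ohd.
  case aE: (atom_at x) => [k|k|k||b|b] /=; rewrite ?ffunE ?ohd ?otp //.
  1-4,6: by case: eqP => [->|].
  by rewrite eqxx tape_of_word_rcons.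
Qed.

Lemma represents_reach t x s b s' : reach w t x s b s' ->
  forall c, represents c (inl x) s ->
  represents (iter t (@tm_step machine) c) (inr b) s'.
Proof.
elim=> {t x s b s'} [x s b|t x y s b s'] nx => [|_ IH] c rep.
  by have := represents_step rep; rewrite nx.
by rewrite iterSr; apply: IH; have := represents_step rep; rewrite nx.
Qed.

Lemma machine_computes b s' c :
  runs w p (fun=> 0, [::]) b s' c ->
  tm_computes_within machine c.+1 w s'.2.
Proof.
move=> [t le_tc /represents_reach rep].
have halted i (d : config machine) : tm_halt (c_state d) ->
    iter i (@tm_step machine) d = d.
  by move=> hd; elim: i => //= i ->; rewrite /tm_step hd.
rewrite /tm_computes_within iterSr -(subnK le_tc) iterD.
have [|st _ _ _ otp] := rep (tm_step (tm_init machine w)).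
  rewrite /tm_step /=; split=> //= [j lt_jK i|i].
    rewrite lt_ord_max in lt_jK; rewrite (negPf lt_jK) ffunE /counter_tape.
    rewrite -[j == ord0]val_eqE /=.
    by case: (_ == 0); case: i => [[|i]|i] //=; case: w.
  have neq : (ord_max == ord0 :> 'I_K.+1) = false.
    by rewrite -val_eqE /= gtn_eqF.
  rewrite (eqxx (ord_max : 'I_K.+1)) ffunE neq if_same.
  by case: i => //= i; rewrite nth_nil.
by rewrite halted ?st.
Qed.

End Machine.

(** * Evaluating a quantifier-free formula on all quadruples *)

Section Programs.
Variable w : seq bool.

Definition does p s s' c := exists b, runs w p s b s' c.

Lemma runs_does p s b s' c : runs w p s b s' c -> does p s s' c.
Proof. by exists b. Qed.

Lemma does_seq p q s s1 c1 s' c2 :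
  does p s s1 c1 -> does q s1 s' c2 -> does (Seq p q) s s' (c1 + c2).
Proof. by move=> [b1 r1] [b2 r2]; exists b2; apply: runs_seq r1 r2. Qed.

Lemma does_weaken c p s s' c' : does p s s' c -> c <= c' -> does p s s' c'.
Proof. by move=> [b r] le; exists b; apply: runs_weaken r le. Qed.

Lemma does_atom a s : does (Atom a) s (atom_apply a s) 1.
Proof. by exists (atom_exit w a s); apply: runs_atom. Qed.

Lemma runs_while_atom a q (S : nat -> mem) n c :
  (forall i, atom_apply a (S i) = S i) ->
  (forall i, i < n -> atom_exit w a (S i)) ->
  (forall i, i < n -> does q (S i) (S i.+1) c) ->
  ~~ atom_exit w a (S n) ->
  runs w (While (Atom a) q) (S 0) false (S n) (n * c.+1 + 1).
Proof.
move=> id_a test body /negPf stop; apply: runs_while => // [i lt_in|].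
  by have := runs_atom w a (S i); rewrite id_a test.
by have := runs_atom w a (S n); rewrite id_a stop.
Qed.

Definition incs (ks : seq nat) : prog :=
  foldr (fun k => Seq (Atom (Inc k))) (Atom (Skip true)) ks.

Definition transfer (k : nat) (ks : seq nat) : prog :=
  While (Atom (NonZero k)) (Seq (Atom (Dec k)) (incs ks)).

Lemma does_incs ks s : uniq ks ->
  does (incs ks) s (fun j => s.1 j + (j \in ks), s.2) (size ks).+1.
Proof.
elim: ks s => [|k ks IH] s /= => [_|/andP[k_notin /IH{}IH]].
  have := does_atom (Skip true) s; congr does; case: s => r o /=.
  by congr pair; apply: functional_extensionality => j; rewrite addn0.
have := does_seq (does_atom (Inc k) s) (IH _); rewrite add1n; congr does.
congr pair; apply: functional_extensionality => j /=.
rewrite in_cons /upd; case: eqP => [->|//].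
by rewrite (negPf k_notin) addn0 addn1.
Qed.

Lemma runs_transfer k ks s : uniq (k :: ks) ->
  runs w (transfer k ks) s false
    (fun j => if j == k then 0 else s.1 j + (j \in ks) * s.1 k, s.2)
    (s.1 k * (size ks).+3 + 1).
Proof.
move=> /= /andP[k_notin uniq_ks]; case: s => r o /=.
pose S i : mem :=
  (fun j => if j == k then r k - i else r j + (j \in ks) * i, o).
have S0 : (r, o) = S 0.
  congr pair; apply: functional_extensionality => j.
  by rewrite subn0 muln0 addn0; case: eqP => [->|].
have Sr : (fun j => if j == k then 0 else r j + (j \in ks) * r k, o) = S (r k).
  by rewrite /S subnn.
rewrite S0 Sr; apply: (@runs_while_atom (NonZero k)) => [//|i lt_i|i lt_i|].
- by rewrite /= eqxx subn_eq0 -ltnNge.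
- have := does_seq (does_atom (Dec k) (S i)) (does_incs _ uniq_ks).
  rewrite add1n; congr does; congr pair.
  apply: functional_extensionality => j /=; rewrite /upd eqxx.
  case: eqP => [->|_]; first by rewrite (negPf k_notin) addn0 subnS.
  by rewrite mulnS -addnA [X in _ + X = _]addnC.
- by rewrite /= eqxx subnn.
Qed.

Lemma does_transfer k ks s : uniq (k :: ks) ->
  does (transfer k ks) s
    (fun j => if j == k then 0 else s.1 j + (j \in ks) * s.1 k, s.2)
    (s.1 k * (size ks).+3 + 1).
Proof. by move=> /runs_transfer/runs_does. Qed.

(* Counter 0 is the input position, 1 holds the size [n] of the current poset,
   2 and 3 are scratch, 4 records how far the input head is from its base, and
   the four loop variables and their distances to [n] are held in 5 to 8 and
   9 to 12. *)
Definition layout pos n t1 t2 d (e : nat -> nat) : nat -> nat :=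
  nth 0 [:: pos; n; t1; t2; d; e 0; e 1; e 2; e 3;
            n - e 0; n - e 1; n - e 2; n - e 3].

Definition state pos n e o : mem := (layout pos n 0 0 0 e, o).

(* From the separator of a poset code, walks to the matrix entry [(a, b)]. *)
Definition walk (a b : nat) : prog :=
  Seq (While (Atom (NonZero (5 + a)))
        (Seq (Atom (Dec (5 + a)))
          (Seq (Atom (Inc 2)) (Seq (transfer 1 [:: 3; 0; 4]) (transfer 3 [:: 1])))))
    (Seq (transfer 2 [:: 5 + a])
      (Seq (transfer (5 + b) [:: 2; 0; 4])
        (Seq (transfer 2 [:: 5 + b]) (Seq (Atom (Inc 0)) (Atom (Inc 4)))))).

Definition walk_back : prog :=
  While (Atom (NonZero 4)) (Seq (Atom (Dec 4)) (Atom (Dec 0))).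

Definition lookup (a b : nat) : prog :=
  Ite (Seq (walk a b) (Atom ReadBit))
    (Seq walk_back (Atom (Skip true))) (Seq walk_back (Atom (Skip false))).

Ltac layout_ext :=
  let j := fresh "j" in
  congr pair; apply: functional_extensionality => j;
  do 13 (destruct j as [|j];
    first by rewrite /= /layout /upd /= ?inE /=; try lia);
  by rewrite /= /layout /upd /= ?nth_nil /= ?inE /=; try lia.

Ltac small a :=
  destruct a as [|[|[|[|a]]]]; last by [].

Lemma does_conv p s s1 c1 s' c :
  does p s s1 c1 -> s1 = s' -> c1 <= c -> does p s s' c.
Proof. by move=> /does_weaken d <- /d. Qed.

Lemma does_walk a b pos n e o : a < 4 -> b < 4 -> e a <= n -> e b <= n ->
  let d := e a * n + e b + 1 in
  does (walk a b) (state pos n e o) (layout (pos + d) n 0 0 d e, o)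
    (n * (10 * n + 5) + 14 * n + 6).
Proof.
move=> lt_a lt_b le_a le_b d; set c := (X in does _ _ _ X).
pose S i : mem :=
  (upd (layout (pos + i * n) n i 0 (i * n) e) (5 + a) (e a - i), o).
have S0 : state pos n e o = S 0.
  rewrite /S /state; small a; layout_ext.
have body i : i < e a -> does (Seq (Atom (Dec (5 + a)))
          (Seq (Atom (Inc 2)) (Seq (transfer 1 [:: 3; 0; 4]) (transfer 3 [:: 1]))))
   (S i) (S i.+1) (10 * n + 4).
  move=> lt_i.
  apply: does_conv (does_seq (does_atom _ _) (does_seq (does_atom _ _)
    (does_seq (@does_transfer 1 [:: 3; 0; 4] _ isT)
              (@does_transfer 3 [:: 1] _ isT)))) _ _.
    rewrite /S; small a; layout_ext.
  rewrite /S; small a; rewrite /= /upd /layout /=; lia.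
have test i : i < e a -> atom_exit w (NonZero (5 + a)) (S i).
  by move=> lt_i; rewrite /S /upd /= eqxx -lt0n subn_gt0.
have stop : ~~ atom_exit w (NonZero (5 + a)) (S (e a)).
  by rewrite /S /upd /= eqxx subnn.
have loop := runs_does (runs_while_atom (fun=> erefl) test body stop).
rewrite S0; apply: does_conv (does_seq loop
  (does_seq (@does_transfer 2 [:: 5 + a] _ _)
    (does_seq (@does_transfer (5 + b) [:: 2; 0; 4] _ _)
       (does_seq (@does_transfer 2 [:: 5 + b] _ _)
          (does_seq (does_atom _ _) (does_atom _ _)))))) _ _; try by [].
- rewrite /S /d; small a; small b; layout_ext.
- rewrite /S /d /c; small a; small b; rewrite /= /upd /layout /= ?inE /=; nia.
Qed.

Lemma does_walk_back pos n d e o :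
  does walk_back (layout (pos + d) n 0 0 d e, o) (state pos n e o) (d * 3 + 1).
Proof.
pose S i : mem := (layout (pos + d - i) n 0 0 (d - i) e, o).
have -> : (layout (pos + d) n 0 0 d e, o) = S 0 by rewrite /S !subn0.
have -> : state pos n e o = S d by rewrite /S addnK subnn.
have test i : i < d -> atom_exit w (NonZero 4) (S i).
  by rewrite /S /layout /= subn_eq0 -ltnNge.
have stop : ~~ atom_exit w (NonZero 4) (S d) by rewrite /S /layout /= subnn.
have body i : i < d -> does (Seq (Atom (Dec 4)) (Atom (Dec 0))) (S i) (S i.+1) 2.
  move=> lt_i; apply: does_conv (does_seq (does_atom _ _) (does_atom _ _)) _ _ => //.
  rewrite /S; layout_ext.
exact: runs_does (runs_while_atom (fun=> erefl) test body stop).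
Qed.

Definition lookup_cost n := 13 * n * n + 30 * n + 15.

Lemma runs_lookup a b pos n e o : a < 4 -> b < 4 -> e a < n -> e b < n ->
  runs w (lookup a b) (state pos n e o)
    (nth false w (pos + (e a * n + e b + 1))) (state pos n e o) (lookup_cost n).
Proof.
move=> lt_a lt_b lt_an lt_bn.
have [b1 rw] := does_walk pos o lt_a lt_b (ltnW lt_an) (ltnW lt_bn).
set d := e a * n + e b + 1 in rw *.
have [b2 rb] := does_walk_back pos n d e o.
have back v : runs w (Seq walk_back (Atom (Skip v))) (layout (pos + d) n 0 0 d e, o)
    v (state pos n e o) (d * 3 + 1 + 1).
  exact: runs_seq rb (runs_atom w (Skip v) _).
set v := nth false w (pos + d).
have test := runs_seq rw (runs_atom w ReadBit _).
have branch : runs w (if v then Seq walk_back (Atom (Skip true))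
    else Seq walk_back (Atom (Skip false)))
  (layout (pos + d) n 0 0 d e, o) v (state pos n e o) (d * 3 + 1 + 1).
  by case: (v); apply: back.
apply: runs_weaken (runs_ite test branch) _.
rewrite /lookup_cost /d; nia.
Qed.

Inductive formula :=
| Le of nat & nat
| Cond of formula & formula & formula
| Const of bool.

Fixpoint formula_ok (f : formula) : bool :=
  match f with
  | Le a b => (a < 4) && (b < 4)
  | Cond f g h => [&& formula_ok f, formula_ok g & formula_ok h]
  | Const _ => true
  end.

Fixpoint holds (r : nat -> nat -> bool) (e : nat -> nat) (f : formula) : bool :=
  match f with
  | Le a b => r (e a) (e b)
  | Cond f g h => if holds r e f then holds r e g else holds r e h
  | Const b => b
  end.

Fixpoint compile (f : formula) : prog :=
  match f with
  | Le a b => lookup a b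
  | Cond f g h => Ite (compile f) (compile g) (compile h)
  | Const b => Atom (Skip b)
  end.

Fixpoint formula_cost (f : formula) n :=
  match f with
  | Le _ _ => lookup_cost n
  | Cond f g h => formula_cost f n + (formula_cost g n + formula_cost h n)
  | Const _ => 1
  end.

Definition entry_at pos n a b := nth false w (pos + (a * n + b + 1)).

Lemma runs_compile f pos n e o :
  formula_ok f -> (forall a, a < 4 -> e a < n) ->
  runs w (compile f) (state pos n e o) (holds (entry_at pos n) e f)
    (state pos n e o) (formula_cost f n).
Proof.
move=> + lt_e; elim: f => [a b|f IHf g IHg h IHh|b] /=.
- by move=> /andP[lt_a lt_b]; apply: runs_lookup; rewrite ?lt_e.
- case/and3P=> /IHf{}IHf /IHg{}IHg /IHh{}IHh.
  apply: runs_weaken (runs_ite IHf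
    (c2 := maxn (formula_cost g n) (formula_cost h n)) _) _.
    case: holds; first exact: runs_weaken IHg (leq_maxl _ _).
    exact: runs_weaken IHh (leq_maxr _ _).
  by rewrite leq_add2l geq_max leq_addr leq_addl.
- by move=> _; apply: (runs_atom w (Skip b)).
Qed.

Definition for_loop (i : nat) (body : prog) : prog :=
  Seq (While (Atom (NonZero (9 + i)))
        (Seq body (Seq (Atom (Dec (9 + i))) (Atom (Inc (5 + i))))))
      (transfer (5 + i) [:: 9 + i]).

Definition for_cost n c := n * (c + 7) + 2.

Lemma flatten_iotaS (T : Type) (f : nat -> seq T) k :
  flatten [seq f i | i <- iota 0 k.+1] = flatten [seq f i | i <- iota 0 k] ++ f k.
Proof. by rewrite -addn1 iotaD map_cat flatten_cat /= cats0. Qed.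

Lemma does_for i body n e pos o (step : nat) (out : nat -> seq bool) c :
  i < 4 -> e i = 0 ->
  (forall k o', k < n -> does body (state (pos + k * step) n (upd e i k) o')
     (state (pos + k.+1 * step) n (upd e i k) (o' ++ out k)) c) ->
  does (for_loop i body) (state pos n e o)
    (state (pos + n * step) n e (o ++ flatten [seq out k | k <- iota 0 n]))
    (for_cost n c).
Proof.
move=> lt_i ei0 bodyP.
pose S k := state (pos + k * step) n (upd e i k)
  (o ++ flatten [seq out k | k <- iota 0 k]).
have S0 : state pos n e o = S 0.
  by rewrite /S /state cats0; small i; rewrite /layout /upd /= ei0 addn0.
have test k : k < n -> atom_exit w (NonZero (9 + i)) (S k).
  by move=> lt_k; small i; rewrite /S /state /layout /upd /=; lia.
have stop : ~~ atom_exit w (NonZero (9 + i)) (S n).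
  by small i; rewrite /S /state /layout /upd /= subnn.
have body' k : k < n -> does
    (Seq body (Seq (Atom (Dec (9 + i))) (Atom (Inc (5 + i))))) (S k) (S k.+1) (c + 2).
  move=> lt_k; apply: does_conv (does_seq (bodyP k _ lt_k)
    (does_seq (does_atom _ _) (does_atom _ _))) _ _ => //.
  rewrite /S /state flatten_iotaS catA.
  small i; layout_ext.
have loop := runs_does (runs_while_atom (fun=> erefl) test body' stop).
rewrite S0.
apply: does_conv (does_seq loop (@does_transfer (5 + i) [:: 9 + i] _ _)) _ _ => //.
- by small i.
- rewrite /S /state; small i; layout_ext.
- rewrite /S /for_cost; small i; rewrite /= /layout /upd /=; lia.
Qed.

Definition parse : prog := While (Atom ReadBit) (incs [:: 0; 1; 9; 10; 11; 12]).

Definition emit_size : prog := for_loop 0 (for_loop 1 (Atom (Out true))).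

Definition emit_matrix (f : formula) : prog :=
  for_loop 0 (for_loop 1 (for_loop 2 (for_loop 3
    (Ite (compile f) (Atom (Out true)) (Atom (Out false)))))).

Definition skip_matrix : prog := for_loop 0 (for_loop 1 (Atom (Inc 0))).

Definition clear : prog :=
  foldr (fun k => Seq (transfer k [::])) (Atom (Inc 0)) [:: 1; 9; 10; 11; 12].

Definition block (f : formula) : prog :=
  Seq parse (Seq emit_size (Seq (Atom (Out false))
    (Seq (emit_matrix f) (Seq skip_matrix clear)))).

Definition no_vars : nat -> nat := fun=> 0.

Lemma does_parse pos n o :
  (forall i, i < n -> nth false w (pos + i)) -> nth false w (pos + n) = false ->
  does parse (state pos 0 no_vars o) (state (pos + n) n no_vars o) (n * 8 + 1).
Proof.
move=> ones zero; pose S i := state (pos + i) i no_vars o.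
have -> : state pos 0 no_vars o = S 0 by rewrite /S addn0.
have -> : state (pos + n) n no_vars o = S n by [].
have body i : i < n -> does (incs [:: 0; 1; 9; 10; 11; 12]) (S i) (S i.+1) 7.
  move=> lt_i; apply: does_conv (@does_incs [:: 0; 1; 9; 10; 11; 12] _ isT) _ _ => //.
  rewrite /S /state /no_vars; layout_ext.
have test i : i < n -> atom_exit w ReadBit (S i) by apply: ones.
have stop : ~~ atom_exit w ReadBit (S n) by rewrite /= zero.
exact: runs_does (runs_while_atom (fun=> erefl) test body stop).
Qed.

Lemma does_for_still i body n e pos o (out : nat -> seq bool) c :
  i < 4 -> e i = 0 ->
  (forall k o', k < n -> does body (state pos n (upd e i k) o')
     (state pos n (upd e i k) (o' ++ out k)) c) ->
  does (for_loop i body) (state pos n e o)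
    (state pos n e (o ++ flatten [seq out k | k <- iota 0 n])) (for_cost n c).
Proof.
move=> lt_i ei0 bodyP.
have := @does_for i body n e pos o 0 out c lt_i ei0.
by rewrite muln0 addn0; apply=> k o' lt_k; rewrite !muln0 addn0; apply: bodyP.
Qed.

Lemma does_emit_size pos n o :
  does emit_size (state pos n no_vars o)
    (state pos n no_vars (o ++ nseq (n * n) true)) (for_cost n (for_cost n 1)).
Proof.
have nseqE m k : nseq (m * k) true = flatten [seq nseq k true | _ <- iota 0 m].
  elim: m => // m IH; rewrite flatten_iotaS -IH -nseqD.
  by rewrite mulSn addnC.
rewrite nseqE; apply: does_for_still => // k o1 lt_k.
rewrite -[n in nseq n]muln1 nseqE; apply: does_for_still => // k' o2 lt_k'.
by rewrite cats1; apply: does_atom.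
Qed.

Definition vars v x u y := upd (upd (upd (upd no_vars 0 v) 1 x) 2 u) 3 y.

Definition matrix_out (r : nat -> nat -> bool) n (f : formula) : seq bool :=
  flatten [seq flatten [seq flatten [seq flatten [seq
    [:: holds r (vars v x u y) f]
    | y <- iota 0 n] | u <- iota 0 n] | x <- iota 0 n] | v <- iota 0 n].

Lemma does_emit_matrix f pos n o : formula_ok f ->
  does (emit_matrix f) (state pos n no_vars o)
    (state pos n no_vars (o ++ matrix_out (entry_at pos n) n f))
    (for_cost n (for_cost n (for_cost n (for_cost n (formula_cost f n + 1))))).
Proof.
move=> f_ok.
apply: does_for_still => // v o1 lt_v; apply: does_for_still => // x o2 lt_x.
apply: does_for_still => // u o3 lt_u; apply: does_for_still => // y o4 lt_y.
have lt_vars a : a < 4 -> vars v x u y a < n by case: a => [|[|[|[|a]]]].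
have test := runs_compile pos o4 f_ok lt_vars.
exists true; apply: runs_ite test _; rewrite cats1.
by case: holds; apply: (runs_atom w (Out _)).
Qed.

Lemma does_skip_matrix pos n o :
  does skip_matrix (state pos n no_vars o) (state (pos + n * n) n no_vars o)
    (for_cost n (for_cost n 1)).
Proof.
have nilE (m : nat) (o' : seq bool) : o' = o' ++ flatten [seq [::] | _ <- iota 0 m].
  by elim: m => [|m IH]; rewrite ?flatten_iotaS cats0.
rewrite {2}(nilE n o); apply: does_for => // k o1 lt_k.
have -> : pos + k.+1 * n = pos + k * n + n * 1 by rewrite mulSn muln1; lia.
have := @does_for 1 (Atom (Inc 0)) n (upd no_vars 0 k) (pos + k * n) o1 1
  (fun=> [::]) 1 isT erefl.
rewrite -nilE cats0; apply=> k' o2 lt_k'.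
apply: does_conv (does_atom _ _) _ _ => //.
by rewrite /state cats0 !muln1; layout_ext.
Qed.

Lemma does_clear pos n o :
  does clear (state pos n no_vars o) (state pos.+1 0 no_vars o)
    (5 * (n * 3 + 1) + 1).
Proof.
apply: does_conv (does_seq (@does_transfer 1 [::] _ isT)
  (does_seq (@does_transfer 9 [::] _ isT) (does_seq (@does_transfer 10 [::] _ isT)
  (does_seq (@does_transfer 11 [::] _ isT) (does_seq (@does_transfer 12 [::] _ isT)
  (does_atom _ _)))))) _ _.
- by rewrite /state /no_vars; layout_ext.
- by rewrite /= /layout /no_vars /=; lia.
Qed.

Lemma does_out b pos n e o :
  does (Atom (Out b)) (state pos n e o) (state pos n e (rcons o b)) 1.
Proof. exact: does_atom. Qed.

Definition block_cost f n :=
  n * 8 + 1 + for_cost n (for_cost n 1) + 1 +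
  for_cost n (for_cost n (for_cost n (for_cost n (formula_cost f n + 1)))) +
  for_cost n (for_cost n 1) + (5 * (n * 3 + 1) + 1).

Lemma does_block f pos n o : formula_ok f ->
  (forall i, i < n -> nth false w (pos + i)) -> nth false w (pos + n) = false ->
  does (block f) (state pos 0 no_vars o)
    (state (pos + n + n * n).+1 0 no_vars
      (o ++ nseq (n * n) true ++ false :: matrix_out (entry_at (pos + n) n) n f))
    (block_cost f n).
Proof.
move=> f_ok ones zero.
apply: does_conv (does_seq (does_parse o ones zero)
  (does_seq (does_emit_size _ _ _) (does_seq (does_out false _ _ _ _)
  (does_seq (does_emit_matrix _ _ _ f_ok) (does_seq (does_skip_matrix _ _ _)
  (does_clear _ _ _)))))) _ _.
- by rewrite /= cat_rcons -catA.
- by rewrite /block_cost; lia.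
Qed.

End Programs.

Lemma compile_ok f : formula_ok f -> prog_ok 13 (compile f).
Proof.
elim: f => [a b|f IHf g IHg h IHh|b] //=; last first.
  by case/and3P=> /IHf -> /IHg -> /IHh ->.
by case/andP; case: a => [|[|[|[|a]]]] //; case: b => [|[|[|[|b]]]].
Qed.

Lemma for_cost_mono n n' c c' :
  n <= n' -> c <= c' -> for_cost n c <= for_cost n' c'.
Proof. by move=> le_n le_c; rewrite leq_add2r leq_mul // leq_add2r. Qed.

Lemma formula_cost_mono f : {homo formula_cost f : n m / n <= m}.
Proof.
move=> n m le_nm; elim: f => [a b|f IHf g IHg h IHh|b] //=; last first.
  by rewrite !leq_add.
by rewrite /lookup_cost !leq_add ?leq_mul.
Qed.

Lemma block_cost_mono f : {homo block_cost f : n m / n <= m}.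
Proof.
move=> n m le_nm.
rewrite /block_cost.
by repeat first [ done | apply: for_cost_mono | apply: formula_cost_mono
                | apply: leq_add | apply: leq_mul ].
Qed.

Definition is_poly (g : nat -> nat) :=
  exists p : {poly nat}, forall n, g n = (p.[n])%R.

Lemma is_poly_const c : is_poly (fun=> c).
Proof. by exists (c%:P)%R => n; rewrite hornerC. Qed.

Lemma is_poly_id : is_poly id.
Proof. by exists 'X%R => n; rewrite hornerX. Qed.

Lemma is_polyD g h : is_poly g -> is_poly h -> is_poly (fun n => g n + h n).
Proof. by move=> [p pE] [q qE]; exists (p + q)%R => n; rewrite hornerD pE qE. Qed.

Lemma is_polyM g h : is_poly g -> is_poly h -> is_poly (fun n => g n * h n).
Proof. by move=> [p pE] [q qE]; exists (p * q)%R => n; rewrite hornerM pE qE. Qed.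

Ltac is_poly_tac :=
  repeat first [ exact: is_poly_id | exact: is_poly_const | assumption
               | apply: is_polyD | apply: is_polyM ].

Lemma is_poly_formula_cost f : is_poly (formula_cost f).
Proof.
by elim: f => [a b|f IHf g IHg h IHh|b]; rewrite /= /lookup_cost; is_poly_tac.
Qed.

Lemma is_poly_block_cost f : is_poly (block_cost f).
Proof.
have := is_poly_formula_cost f.
by rewrite /block_cost /for_cost => ?; is_poly_tac.
Qed.

Definition order_matrix (P : finite_poset) : seq bool :=
  [seq P x y | x <- enum 'I_(fp_size P), y <- enum 'I_(fp_size P)].

Definition nat_le (P : finite_poset) (a b : nat) : bool :=
  nth false (order_matrix P) (a * fp_size P + b).

Lemma flatten_iotaM (T : Type) (H : nat -> seq T) m n :
  flatten [seq H k | k <- iota 0 (m * n)] =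
  flatten [seq flatten [seq H (v * n + x) | x <- iota 0 n] | v <- iota 0 m].
Proof.
elim: m => // m IH; rewrite flatten_iotaS -IH mulSn addnC iotaD map_cat flatten_cat.
by rewrite add0n -[in iota (m * n)](addn0 (m * n)) iotaDl -map_comp.
Qed.

Lemma allpairs_ord (n : nat) (r : 'I_n -> 'I_n -> bool) (g : nat -> nat -> bool) :
  (forall x y : 'I_n, r x y = g x y) ->
  [seq r x y | x <- enum 'I_n, y <- enum 'I_n] =
  flatten [seq [seq g x y | y <- iota 0 n] | x <- iota 0 n].
Proof.
move=> rE; rewrite -val_enum_ord -map_comp; congr flatten; apply: eq_map => x /=.
by rewrite -map_comp; apply: eq_map => y /=.
Qed.

Lemma nat_leE P (x y : 'I_(fp_size P)) : nat_le P x y = P x y.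
Proof.
set n := fp_size P in x y *.
have size_rows s : size (flatten [seq [seq P i j | j <- enum 'I_n] | i <- s])
    = size s * n.
  by elim: s => //= i s IH; rewrite size_cat IH size_map size_enum_ord mulSn.
rewrite /nat_le /order_matrix -/n.
rewrite -[X in flatten (map _ X)](cat_take_drop x) map_cat flatten_cat nth_cat.
rewrite [size _]size_rows size_take size_enum_ord ltn_ord.
rewrite ltnNge leq_addr /= addKn (drop_nth x) ?size_enum_ord //= nth_cat.
by rewrite size_map size_enum_ord ltn_ord (nth_map y) ?size_enum_ord // !nth_ord_enum.
Qed.

Lemma eq_holds f r r' e n : formula_ok f -> (forall a, a < 4 -> e a < n) ->
  (forall a b, a < n -> b < n -> r a b = r' a b) -> holds r e f = holds r' e f.
Proof.
move=> + lt_e eq_r; elim: f => [a b|f IHf g IHg h IHh|b] //=.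
  by case/andP=> lt_a lt_b; rewrite eq_r ?lt_e.
by case/and3P=> /IHf -> /IHg -> /IHh ->.
Qed.

Lemma eq_matrix_out f r r' n : formula_ok f ->
  (forall a b, a < n -> b < n -> r a b = r' a b) ->
  matrix_out r n f = matrix_out r' n f.
Proof.
move=> f_ok eq_r.
congr flatten; apply/eq_in_map => v; rewrite mem_iota => lt_v.
congr flatten; apply/eq_in_map => x; rewrite mem_iota => lt_x.
congr flatten; apply/eq_in_map => u; rewrite mem_iota => lt_u.
congr flatten; apply/eq_in_map => y; rewrite mem_iota => lt_y.
by rewrite (@eq_holds f r r' _ n) // => -[|[|[|[|a]]]].
Qed.

Lemma does_encoded f (P : finite_poset) pre post o : formula_ok f ->
  let w := pre ++ encode_poset P ++ post in
  let n := fp_size P in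
  does w (block f) (state (size pre) 0 no_vars o)
    (state (size pre + size (encode_poset P)) 0 no_vars
      (o ++ nseq (n * n) true ++ false :: matrix_out (nat_le P) n f))
    (block_cost f n).
Proof.
move=> f_ok w n.
have nth_w i : nth false w (size pre + i) = nth false (encode_poset P ++ post) i.
  by rewrite /w nth_cat ltnNge leq_addr /= addKn.
have size_mat : size (order_matrix P) = n * n.
  by rewrite size_allpairs !size_enum_ord.
have := @does_block w f (size pre) n o f_ok.
have -> : (size pre + n + n * n).+1 = size pre + size (encode_poset P).
  by rewrite size_cat size_nseq /= -size_mat -addnS addnA.
rewrite (@eq_matrix_out f _ (nat_le P)) // => [|a b lt_a lt_b]; last first.
  rewrite /entry_at -addnA nth_w -catA nth_cat size_nseq -/n ltnNge leq_addr /= addKn.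
  rewrite addn1 /= nth_cat [size _]size_mat.
  have -> // : a * n + b < n * n.
  by nia.
apply=> [i lt_in|]; rewrite nth_w -catA nth_cat size_nseq.
  by rewrite lt_in nth_nseq lt_in.
by rewrite ltnn subnn.
Qed.

Section Square.
Variable n : nat.

Lemma ord_sqr_fst (i : 'I_(n * n)) : i %/ n < n.
Proof. by rewrite ltn_divLR //; case: n i => [[]|]. Qed.

Lemma ord_sqr_snd (i : 'I_(n * n)) : i %% n < n.
Proof. by rewrite ltn_mod; case: n i => [[]|]. Qed.

Definition unpair (i : 'I_(n * n)) : 'I_n * 'I_n :=
  (Ordinal (ord_sqr_fst i), Ordinal (ord_sqr_snd i)).

Lemma unpair_bij : bijective unpair.
Proof.
apply: inj_card_bij; last by rewrite card_prod !card_ord.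
move=> i j [eq_div eq_mod]; apply: val_inj.
by rewrite /= (divn_eq i n) (divn_eq j n) eq_div eq_mod.
Qed.

End Square.

Section Pullback.
Variables (T U : finType) (f : T -> U) (f_inj : injective f) (Q : poset U).

Definition pullback_rel : rel T := fun x y => Q (f x) (f y).

Lemma pullback_refl : reflexive pullback_rel.
Proof. by move=> x; apply: Defs.le_refl. Qed.

Lemma pullback_anti : antisymmetric pullback_rel.
Proof. by move=> x y /Defs.le_anti /f_inj. Qed.

Lemma pullback_trans : transitive pullback_rel.
Proof. by move=> y x z; apply: Defs.le_trans. Qed.

Definition pullback := Poset pullback_refl pullback_anti pullback_trans.

End Pullback.

Definition square n (Q : poset ('I_n * 'I_n)%type) : finite_poset :=
  FinitePoset (pullback (bij_inj (@unpair_bij n)) Q).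

Lemma order_matrix_square n (Q : poset ('I_n * 'I_n)%type) r f :
  (forall v x u y, Q (v, x) (u, y) = holds r (vars v x u y) f) ->
  order_matrix (square Q) = matrix_out r n f.
Proof.
move=> QE; pose g i j := holds r (vars (i %/ n) (i %% n) (j %/ n) (j %% n)) f.
rewrite /order_matrix (@allpairs_ord _ _ g) /=; last first.
  by move=> i j; apply: (QE (Ordinal _) (Ordinal _) (Ordinal _) (Ordinal _)).
rewrite flatten_iotaM.
have modE v x : x \in iota 0 n -> ((v * n + x) %/ n = v) * ((v * n + x) %% n = x).
  rewrite mem_iota => /= lt_x; have n_gt0 : 0 < n by apply: leq_ltn_trans lt_x.
  by rewrite divnMDl // divn_small // addn0 modnMDl modn_small.
congr flatten; apply/eq_in_map => v _; congr flatten; apply/eq_in_map => x x_in.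
rewrite -(flatten_seq1 [seq _ | _ <- _]) -map_comp flatten_iotaM.
congr flatten; apply/eq_in_map => u _; congr flatten; apply/eq_in_map => y y_in.
by rewrite /= /g !modE.
Qed.

Theorem interpretation_polytime f
    (F : forall P : finite_poset, poset ('I_(fp_size P) * 'I_(fp_size P))%type) :
  formula_ok f ->
  (forall (P : finite_poset) v x u y,
     F P (v, x) (u, y) = holds (nat_le P) (vars v x u y) f) ->
  polytime_computable encode_poset_pair encode_poset_pair
    (fun PQ => (square (F PQ.1), square (F PQ.2))).
Proof.
move=> f_ok FE.
have [p pE] : is_poly (fun n => block_cost f n + block_cost f n + 1).
  by have := is_poly_block_cost f => ?; is_poly_tac.
exists (machine 13 (Seq (block f) (block f))), p => -[P Q].
set w := encode_poset_pair (P, Q).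
have le_size (R : finite_poset) : fp_size R <= size (encode_poset R).
  by rewrite size_cat size_nseq leq_addr.
have size_w : size w = size (encode_poset P) + size (encode_poset Q).
  exact: size_cat.
have := does_encoded Q (encode_poset P) [::] _ f_ok.
have := does_encoded P [::] (encode_poset Q) [::] f_ok.
rewrite /= cats0 -[_ ++ _]/w add0n => d1 d2.
have [b r] := does_seq d1 (d2 _).
have {}r := runs_weaken r (leq_add (block_cost_mono f (leq_trans (le_size P) _))
  (block_cost_mono f (leq_trans (le_size Q) _))).
have init : (fun=> 0, [::]) = state 0 0 no_vars [::].
  congr pair; apply: functional_extensionality => j.
  by do 13 (case: j => [//|j]); rewrite /layout /= nth_nil.
have ok : prog_ok 13 (Seq (block f) (block f)) by rewrite /= !compile_ok.
rewrite -pE addn1.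
have [le_P le_Q] : size (encode_poset P) <= size w /\ size (encode_poset Q) <= size w.
  by rewrite size_w leq_addr leq_addl.
have r' := r _ _ le_P le_Q; rewrite -init in r'.
have := machine_computes (K := 13) isT ok r'.
have encE R : encode_poset (square (F R)) = nseq (fp_size R * fp_size R) true ++
    false :: matrix_out (nat_le R) (fp_size R) f.
  by rewrite -(order_matrix_square (FE R)).
by rewrite /encode_poset_pair !encE.
Qed.

(** * Rotation equivalence as a cohomology class *)

Definition weight (T : finType) (r : rel T) x y : int :=
  ((r y x : nat)%:Z - (r x y : nat)%:Z)%R.

Definition curl (T : finType) (r : rel T) x y z : int :=
  (weight r x y + weight r y z + weight r z x)%R.

Section Weight.
Variable T : finType.
Implicit Types (r : rel T) (P R : poset T) (A C : {set T}).

Lemma weightC r x y : (weight r y x = - weight r x y)%R.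
Proof. by rewrite /weight; lia. Qed.

Lemma weight_range r x y : (-1 <= weight r x y <= 1)%R.
Proof. by rewrite /weight; case: (r x y); case: (r y x). Qed.

Lemma le_weight r : reflexive r -> antisymmetric r ->
  forall x y, r x y = (x == y) || (weight r x y == -1)%R.
Proof.
move=> r_refl r_anti x y; case: eqP => [->|neq]; first by rewrite r_refl.
rewrite /weight; case xy: (r x y); case yx: (r y x) => //.
by case: neq; apply: r_anti; rewrite xy yx.
Qed.

Lemma curl_range P x y z : (-1 <= curl P x y z <= 1)%R.
Proof.
have tr a b c : P a b ==> P b c ==> P a c.
  by apply/implyP => ab; apply/implyP; apply: Defs.le_trans.
move: (tr x y z) (tr y z x) (tr z x y) (tr x z y) (tr z y x) (tr y x z).
rewrite /curl /weight.
by case: (P x y); case: (P y x); case: (P x z); case: (P z x); case: (P y z);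
  case: (P z y).
Qed.

Definition charge A C x : int := ((x \in A : nat)%:Z - (x \in C : nat)%:Z)%R.

Lemma rotatable_bool P A C : rotatable P A C ->
  [/\ forall x, ~~ ((x \in A) && (x \in C)),
      forall x y, (x \in A) && (y \notin A) ==> ~~ P y x,
      forall x y, (x \in C) && (y \notin C) ==> ~~ P x y
    & forall x y, (x \in A) && (y \in C) ==> P x y && ~~ P y x].
Proof.
case=> disj down up ltAC; split=> [x|x y|x y|x y].
- by apply/andP => -[xA xC]; have := disjointFr disj xA; rewrite xC.
- apply/implyP => /andP[xA yA]; apply: contra (yA) => yx; apply: (down x y xA).
  by rewrite /lt_of yx andbT; apply: contraNneq yA => ->.
- apply/implyP => /andP[xC yC]; apply: contra (yC) => xy; apply: (up x y xC).
  by rewrite /lt_of xy andbT; apply: contraNneq yC => <-.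
- apply/implyP => /andP[xA yC]; have /andP[neq xy] := ltAC _ _ xA yC.
  rewrite xy /=; apply: contra neq => yx; apply/eqP; apply: (@Defs.le_anti _ P).
  by rewrite xy.
Qed.

Ltac case_rotation :=
  rewrite /rotation /incomp ?inE;
  repeat match goal with
  | |- context [?x \in ?A] => case: (x \in A) => //=
  end.

Lemma weight_rotation P A C x y : rotatable P A C ->
  weight (rotation A C P) x y = (weight P x y + charge A C x - charge A C y)%R.
Proof.
case/rotatable_bool=> dis down up ltAC.
move: (dis x) (dis y) (down x y) (down y x) (up x y) (up y x) (ltAC x y) (ltAC y x).
rewrite /weight /charge.
by case_rotation; case: (P x y) => //=; case: (P y x).
Qed.

Lemma rotation_refl P A C : reflexive (rotation A C P).
Proof. by move=> x; have := Defs.le_refl P x; case_rotation => ->. Qed.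

Lemma rotation_anti P A C : rotatable P A C -> antisymmetric (rotation A C P).
Proof.
case/rotatable_bool=> dis _ _ _ x y xy; apply: (@Defs.le_anti _ P).
by move: (dis x) (dis y) xy; case_rotation; case: (P x y) => //=; case: (P y x).
Qed.

Lemma curl_rotation P A C x y z : rotatable P A C ->
  curl (rotation A C P) x y z = curl P x y z.
Proof. by move=> AC; rewrite /curl !weight_rotation //; lia. Qed.

(* If [x < y < z] after the rotation, then the curl of [x], [y], [z], which the
   rotation preserves, is at least [-1] and forces [weight z x = 1]. *)
Lemma rotation_trans P A C : rotatable P A C -> transitive (rotation A C P).
Proof.
move=> AC y x z; set r := rotation A C P.
rewrite !(le_weight (@rotation_refl P A C) (rotation_anti AC) : forall x y, r x y = _).
case: eqP => [->//|_] /= /eqP xy; case: eqP => [<-|_] /=; first by rewrite xy eqxx orbT.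
move/eqP=> yz; apply/orP; right; apply/eqP; rewrite -/r in xy yz *.
have := curl_range P x y z; rewrite -(curl_rotation _ _ _ AC) -/r /curl.
have := weight_range r z x; rewrite (weightC r z x); lia.
Qed.

Definition rotate P A C (AC : rotatable P A C) : poset T :=
  Poset (@rotation_refl P A C) (rotation_anti AC) (rotation_trans AC).

Lemma rotation_inverse P A C : rotatable P A C ->
  rotatable (rotation A C P) C A /\ rotation C A (rotation A C P) =2 P.
Proof.
move=> AC; have [dis down up ltAC] := rotatable_bool AC.
have [disj _ _ _] := AC.
have CA : rotatable (rotate AC) C A.
  split; first by rewrite disjoint_sym.
  - move=> x y + /andP[_] /=; move: (dis x) (dis y); by case_rotation.
  - move=> x y + /andP[_] /=; move: (dis x) (dis y); by case_rotation.
  - move=> x y xC yA; apply/andP; split; last first.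
      by move: xC yA; rewrite /=; case_rotation; rewrite ?orbT.
    by apply: contraNneq (dis y) => xy; rewrite yA -xy xC.
split=> // x y.
rewrite (le_weight (@rotation_refl (rotate AC) C A) (rotation_anti CA)).
rewrite (le_weight (@Defs.le_refl _ P) (@Defs.le_anti _ P)).
rewrite (weight_rotation _ _ CA) /= (weight_rotation _ _ AC) /charge.
by congr (_ || (_ == _)); lia.
Qed.

Definition down P v := [set x | P x v].
Definition strict_up P v := [set x | P v x && (x != v)].

Lemma star_rotatable P v : rotatable P (down P v) (strict_up P v).
Proof.
split.
- rewrite -setI_eq0; apply/eqP/setP => x; rewrite !inE.
  apply/negbTE/and3P => -[xv vx /eqP]; apply; apply: (@Defs.le_anti _ P).
  by rewrite xv.
- by move=> x y; rewrite !inE => xv /andP[_ yx]; apply: Defs.le_trans xv.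
- move=> x y; rewrite !inE => /andP[vx neq] /andP[neqxy xy].
  rewrite (Defs.le_trans vx xy); apply: contraNneq neq => yv.
  by apply/eqP; apply: (@Defs.le_anti _ P); rewrite vx -yv xy.
- move=> x y; rewrite !inE => xv /andP[vy neq]; apply/andP; split; last first.
    exact: Defs.le_trans vy.
  apply: contraNneq neq => xy; apply/eqP; apply: (@Defs.le_anti _ P).
  by rewrite vy -xy xv.
Qed.

Definition star P v : poset T := rotate (star_rotatable P v).

Lemma weight_star P v x y : weight (star P v) x y =
  (curl P v x y + (x == v : nat)%:Z - (y == v : nat)%:Z)%R.
Proof.
have chargeE z :
    charge (down P v) (strict_up P v) z = (weight P v z + (z == v : nat)%:Z)%R.
  rewrite /charge /weight !inE; case: eqP => [->|_]; last by rewrite andbT; lia.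
  by rewrite Defs.le_refl.
have -> := weight_rotation x y (star_rotatable P v); rewrite !chargeE /curl.
by rewrite (weightC P v y); lia.
Qed.

Lemma star_top P v x : star P v x v.
Proof.
rewrite (le_weight (@Defs.le_refl _ _) (@Defs.le_anti _ _)) weight_star eqxx.
by case: eqP => //= _; rewrite /curl (weightC P x v) /weight; lia.
Qed.

Lemma star_curl P R v : (forall x y z, curl P x y z = curl R x y z) ->
  star P v =2 star R v.
Proof.
by move=> eq_curl x y; rewrite !(le_weight (@Defs.le_refl _ _) (@Defs.le_anti _ _))
  !weight_star eq_curl.
Qed.

Lemma rotates_to_curl P r : rotates_to P r ->
  forall x y z, curl r x y z = curl P x y z.
Proof.
move: {1 3}(le P) (erefl (le P)) => r0 + rot.
elim: rot P => {r0 r} [r r' eq_r|r r' A C AC _ IH] P.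
  by move=> rE x y z; rewrite /curl /weight -!eq_r rE.
move=> rE x y z; rewrite rE in AC IH *.
by rewrite (IH (rotate AC)) // curl_rotation.
Qed.

Lemma rotation_equivalentP P R :
  rotation_equivalent P R <-> forall x y z, curl P x y z = curl R x y z.
Proof.
split=> [/rotates_to_curl eq_curl x y z|eq_curl]; first by rewrite eq_curl.
case: (pickP T) => [v _|T0]; last by apply: rotates_to_refl => x; have := T0 x.
apply: rotates_to_step (star_rotatable P v) _.
have eqPR := star_curl v eq_curl.
have [rot inv] := rotation_inverse (star_rotatable R v).
have -> : rotation (down P v) (strict_up P v) P = rotation (down R v) (strict_up R v) R.
  by apply: functional_extensionality => x; apply: functional_extensionality => y;
    apply: eqPR.
exact: rotates_to_step rot (rotates_to_refl inv).
Qed.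

End Weight.

Section Isomorphism.
Variables T U : finType.
Implicit Types (P : poset T) (Q : poset U).

Definition curl_isomorphic P Q : Prop :=
  exists2 f : T -> U, bijective f &
    forall x y z, curl P x y z = curl Q (f x) (f y) (f z).

Lemma poset_isomorphic_weight P Q (f : T -> U) : bijective f ->
  (forall x y, weight P x y = weight Q (f x) (f y)) -> poset_isomorphic P Q.
Proof.
move=> f_bij eq_w; exists f => // x y.
rewrite (le_weight (@Defs.le_refl _ P) (@Defs.le_anti _ P)).
rewrite (le_weight (@Defs.le_refl _ Q) (@Defs.le_anti _ Q)).
by rewrite eq_w (bij_eq f_bij).
Qed.

Lemma curl_isomorphicP P Q :
  curl_isomorphic P Q <->
  exists2 R : poset T, rotation_equivalent P R & poset_isomorphic R Q.
Proof.
split=> [[f f_bij eq_curl]|[R /rotation_equivalentP PR [f f_bij fE]]].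
  exists (pullback (bij_inj f_bij) Q); last by exists f.
  by apply/rotation_equivalentP => x y z; rewrite eq_curl.
by exists f => // x y z; rewrite PR /curl /weight !fE.
Qed.

End Isomorphism.

Lemma poset_isomorphic_pullback (T T' U U' : finType) (f : T -> T') (g : U -> U')
    (f_bij : bijective f) (g_bij : bijective g) (P : poset T') (Q : poset U') :
  poset_isomorphic (pullback (bij_inj f_bij) P) (pullback (bij_inj g_bij) Q) <->
  poset_isomorphic P Q.
Proof.
have [f' fK f'K] := f_bij; have [g' gK g'K] := g_bij.
have [f'_bij g'_bij] : bijective f' /\ bijective g' by split; [exists f|exists g].
split=> -[h h_bij hE].
  exists (g \o h \o f'); first exact: bij_comp (bij_comp g_bij h_bij) f'_bij.
  by move=> x y; rewrite /= -[RHS]hE /= /pullback_rel !f'K.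
exists (g' \o h \o f); first exact: bij_comp (bij_comp g'_bij h_bij) f_bij.
by move=> x y; rewrite /= /pullback_rel /= !g'K -hE.
Qed.

Lemma curl_isomorphic_pullback (T T' U U' : finType) (f : T -> T') (g : U -> U')
    (f_bij : bijective f) (g_bij : bijective g) (P : poset T') (Q : poset U') :
  curl_isomorphic (pullback (bij_inj f_bij) P) (pullback (bij_inj g_bij) Q) <->
  curl_isomorphic P Q.
Proof.
have [f' fK f'K] := f_bij; have [g' gK g'K] := g_bij.
have [f'_bij g'_bij] : bijective f' /\ bijective g' by split; [exists f|exists g].
split=> -[h h_bij hE].
  exists (g \o h \o f'); first exact: bij_comp (bij_comp g_bij h_bij) f'_bij.
  move=> x y z; transitivity (curl (pullback (bij_inj f_bij) P) (f' x) (f' y) (f' z)).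
    by rewrite /curl /weight /= /pullback_rel !f'K.
  by rewrite hE.
exists (g' \o h \o f); first exact: bij_comp (bij_comp g'_bij h_bij) f_bij.
move=> x y z; transitivity (curl P (f x) (f y) (f z)) => //.
by rewrite hE /curl /weight /= /pullback_rel /= !g'K.
Qed.

(** * From rotation equivalence to isomorphism *)

Section Forest.
Variables (T : finType) (P : poset T).

Definition forest_rel : rel (T * T) :=
  fun p q => (p.1 == q.1) && star P p.1 p.2 q.2.

Lemma forest_relE v x u y : forest_rel (v, x) (u, y) = (v == u) && star P v x y.
Proof. by []. Qed.

Lemma forest_refl : reflexive forest_rel.
Proof. by move=> [v x]; rewrite forest_relE eqxx Defs.le_refl. Qed.

Lemma forest_anti : antisymmetric forest_rel.
Proof.
move=> [v x] [u y]; rewrite !forest_relE => /andP[/andP[/eqP <- xy] /andP[_ yx]].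
by congr pair; apply: (@Defs.le_anti _ (star P v)); rewrite xy.
Qed.

Lemma forest_trans : transitive forest_rel.
Proof.
move=> [u y] [v x] [t z]; rewrite !forest_relE => /andP[/eqP <- xy] /andP[/eqP <- yz].
by rewrite eqxx; apply: Defs.le_trans yz.
Qed.

Definition forest := Poset forest_refl forest_anti forest_trans.

Lemma forestE v x u y : forest (v, x) (u, y) = (v == u) && star P v x y.
Proof. by []. Qed.

End Forest.

(* The tops of the components of a forest are its maximal elements, hence an
   isomorphism maps a component [star P v] onto a component [star Q u]. *)
Lemma forest_component (T U : finType) (P : poset T) (Q : poset U)
    (h : T * T -> U * U) (v : T) : bijective h ->
  (forall p q, forest P p q = forest Q (h p) (h q)) ->
  let u := (h (v, v)).1 in
  h (v, v) = (u, u) /\ forall x, (h (v, x)).1 = u.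
Proof.
move=> [h' hK h'K] hE u.
have maxE : h (v, v) = (u, u).
  have : forest Q (h (v, v)) (h (h' (u, u))).
    by rewrite h'K [h (v, v)]surjective_pairing forestE eqxx star_top.
  rewrite -hE; case hE': (h' (u, u)) => [t y].
  rewrite forestE => /andP[/eqP vt vy].
  rewrite -[RHS]h'K hE' -vt; congr (h (_, _)).
  by apply: (@Defs.le_anti _ (star P v)); rewrite vy star_top.
split=> // x; have : forest Q (h (v, x)) (h (v, v)).
  by rewrite -hE forestE eqxx star_top.
by rewrite maxE => /andP[/eqP].
Qed.

Lemma curl_forest (T U : finType) (P : poset T) (Q : poset U) :
  curl_isomorphic P Q <-> poset_isomorphic (forest P) (forest Q).
Proof.
split=> [[f f_bij eq_curl]|[h h_bij hE]].
  have [g fK gK] := f_bij.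
  exists (fun p => (f p.1, f p.2)).
    by exists (fun p => (g p.1, g p.2)) => -[x y] /=; rewrite ?fK ?gK.
  move=> [v x] [u y]; rewrite !forestE (bij_eq f_bij).
  rewrite !(le_weight (@Defs.le_refl _ _) (@Defs.le_anti _ _)).
  by rewrite !weight_star eq_curl !(bij_eq f_bij).
have card_eq : #|T| = #|U|.
  by apply/eqP; rewrite -eqn_sqr -!mulnn -!card_prod; apply/eqP/bij_eq_card/h_bij.
case: (pickP T) => [v _|T0]; last first.
  have f : T -> U by move=> x; have := T0 x.
  exists f; last by move=> x; have := T0 x.
  by apply: inj_card_bij; [move=> x; have := T0 x | rewrite card_eq].
have [maxE fstE] := forest_component v h_bij hE.
set u := (h (v, v)).1 in maxE fstE.
pose s x := (h (v, x)).2.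
have hs x : h (v, x) = (u, s x) by rewrite [LHS]surjective_pairing fstE.
have s_inj : injective s.
  move=> x y sxy; have [//] : (v, x) = (v, y).
  by apply: (bij_inj h_bij); rewrite !hs sxy.
exists s; first by apply: inj_card_bij => //; rewrite card_eq.
have starE x y : star P v x y = star Q u (s x) (s y).
  by have := hE (v, x) (v, y); rewrite !hs !forestE !eqxx.
move=> x y z; have cP := curl_rotation x y z (star_rotatable P v).
have cQ := curl_rotation (s x) (s y) (s z) (star_rotatable Q u).
by rewrite -cP -cQ /curl /weight -![rotation _ _ _]/(le (star _ _)) !starE.
Qed.

(** * From isomorphism to rotation equivalence *)

Section Diagonal.
Variables (T : finType) (P : poset T).

(* [P] lives on the diagonal; the added isolated points are the other pairs. *)
Definition diag_rel : rel (T * T) :=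
  fun p q => (p == q) || [&& p.1 == p.2, q.1 == q.2 & P p.1 q.1].

Lemma diag_refl : reflexive diag_rel.
Proof. by move=> p; rewrite /diag_rel eqxx. Qed.

Lemma diag_anti : antisymmetric diag_rel.
Proof.
move=> [v x] [u y]; rewrite /diag_rel [(u, y) == _]eq_sym; case: eqP => //= _.
case/andP=> /and3P[/eqP <- /eqP <- vu] /and3P[_ _ uv].
by rewrite (@Defs.le_anti _ P v u) ?vu.
Qed.

Lemma diag_trans : transitive diag_rel.
Proof.
move=> q p r; rewrite /diag_rel; case: eqP => [->//|_] /= pq.
case: eqP => [<-|_] /=; first by rewrite pq orbT.
case/and3P: pq => -> _ pq /and3P[_ -> qr] /=.
by rewrite (Defs.le_trans pq qr) orbT.
Qed.

Definition diag := Poset diag_refl diag_anti diag_trans.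

Lemma weight_diag x y : weight diag (x, x) (y, y) = weight P x y.
Proof.
rewrite /weight /= /diag_rel !eqxx /= !xpair_eqE !andbb.
by case: (eqVneq x y) => [->|neq]; rewrite ?Defs.le_refl.
Qed.

Lemma weight_diag0 p q : p.1 != p.2 -> weight diag p q = 0%R.
Proof.
move=> /negPf neq; rewrite /weight /= /diag_rel neq !andbF !orbF.
by rewrite eq_sym subrr.
Qed.

End Diagonal.

Definition isolated (T : finType) (r : rel T) : pred T :=
  fun x => [forall y, weight r x y == 0%R].

Lemma isolatedP (T : finType) (r : rel T) x :
  reflect (forall y, weight r x y = 0%R) (isolated r x).
Proof. exact: 'forall_eqP. Qed.

Lemma isolated_diag (T : finType) (P : poset T) x :
  isolated (diag P) (x, x) = isolated P x.
Proof.
apply/isolatedP/isolatedP => [iso y|iso [u y]]; first by rewrite -weight_diag.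
case: (eqVneq u y) => [->|neq]; first by rewrite weight_diag.
by rewrite weightC weight_diag0 ?oppr0.
Qed.

Section Cancellation.
Variables (T U : finType) (P : poset T) (Q : poset U) (h : T * T -> U * U).
Hypotheses (h_bij : bijective h)
  (hE : forall p q, weight (diag P) p q = weight (diag Q) (h p) (h q)).

Lemma isolated_iso p : isolated (diag Q) (h p) = isolated (diag P) p.
Proof.
have [h' hK h'K] := h_bij.
by apply/isolatedP/isolatedP => iso q; [rewrite hE|rewrite -(h'K q) -hE].
Qed.

Definition diag_map x := (h (x, x)).1.

Lemma diag_mapE x : ~~ isolated P x -> h (x, x) = (diag_map x, diag_map x).
Proof.
rewrite -isolated_diag -isolated_iso /diag_map; case: (h _) => u y /=.
case: (eqVneq u y) => [->//|neq] /negP[].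
by apply/isolatedP => q; apply: weight_diag0.
Qed.

Lemma diag_map_inj : {in [predC isolated P] &, injective diag_map}.
Proof.
move=> x y x_in y_in eq_s.
have [] : (x, x) = (y, y) => //.
by apply: (bij_inj h_bij); rewrite !diag_mapE // eq_s.
Qed.

Lemma diag_map_isolated x : ~~ isolated P x -> ~~ isolated Q (diag_map x).
Proof.
by move=> x_in; rewrite -isolated_diag -diag_mapE // isolated_iso isolated_diag.
Qed.

Lemma leq_card_isolatedC : #|[predC isolated P]| <= #|[predC isolated Q]|.
Proof.
rewrite -(card_in_imset diag_map_inj); apply/subset_leq_card/subsetP.
move=> _ /imsetP[x x_in ->].
exact: diag_map_isolated.
Qed.

End Cancellation.

Lemma diag_cancel (T U : finType) (P : poset T) (Q : poset U) (h : T * T -> U * U) :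
  #|T| = #|U| -> bijective h ->
  (forall p q, weight (diag P) p q = weight (diag Q) (h p) (h q)) ->
  poset_isomorphic P Q.
Proof.
move=> card_eq h_bij hE; have [h' hK h'K] := h_bij.
have h'_bij : bijective h' by exists h.
have h'E p q : weight (diag Q) p q = weight (diag P) (h' p) (h' q).
  by rewrite hE !h'K.
have cardN : #|[predC isolated P]| = #|[predC isolated Q]|.
  apply/eqP; rewrite eqn_leq (leq_card_isolatedC h_bij hE).
  exact: (leq_card_isolatedC h'_bij h'E).
have cardI : #|isolated P| = #|isolated Q|.
  by apply/eqP; rewrite -(eqn_add2r #|[predC isolated P]|) cardC cardN cardC card_eq.
pose s := diag_map h.
pose t x := nth (s x) (enum (isolated Q)) (index x (enum (isolated P))).
have lt_index x : isolated P x ->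
    index x (enum (isolated P)) < size (enum (isolated Q)).
  by move=> x_in; rewrite -cardE -cardI cardE index_mem mem_enum.
have t_in x : isolated P x -> isolated Q (t x).
  by move=> x_in; have := mem_nth (s x) (lt_index x x_in); rewrite mem_enum.
have t_inj x y : isolated P x -> isolated P y -> t x = t y -> x = y.
  move=> x_in y_in; rewrite /t (set_nth_default (s y)) ?lt_index // => /eqP.
  rewrite nth_uniq ?lt_index ?enum_uniq // => /eqP.
  by apply: (@index_inj _ x (enum (isolated P))); rewrite mem_enum.
pose g x := if isolated P x then t x else s x.
have g_iso x : isolated Q (g x) = isolated P x.
  rewrite /g; case: ifPn => [/t_in //|x_in].
  exact: negbTE (diag_map_isolated h_bij hE x_in).
have g_inj : injective g.
  move=> x y gxy; have := g_iso y; rewrite -gxy g_iso => iso_xy; move: gxy.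
  rewrite /g iso_xy; case: ifPn => y_in; first by apply: t_inj; rewrite ?iso_xy.
  have x_in : ~~ isolated P x by rewrite iso_xy.
  exact: (diag_map_inj h_bij hE x_in y_in).
apply: (poset_isomorphic_weight (f := g)).
  by apply: inj_card_bij => //; rewrite card_eq.
move=> x y; case x_in: (isolated P x).
  have /isolatedP -> := x_in.
  by have /isolatedP -> : isolated Q (g x) by rewrite g_iso.
case y_in: (isolated P y).
  rewrite weightC (weightC _ (g y)); have /isolatedP -> := y_in.
  by have /isolatedP -> : isolated Q (g y) by rewrite g_iso.
rewrite -weight_diag hE !(diag_mapE h_bij hE) ?x_in ?y_in //.
by rewrite weight_diag /g x_in y_in.
Qed.

(* There are at least as many off-diagonal points as diagonal ones.  So either
   one of them stays off the diagonal, or all of them fill the diagonal of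
   [diag Q], whose points then have vanishing mutual weights. *)
Lemma isolated_to_isolated (T U : finType) (P : poset T) (Q : poset U)
    (h : T * T -> U * U) :
  #|T| = #|U| -> 1 < #|T| -> bijective h ->
  (forall x y z, curl (diag P) x y z = curl (diag Q) (h x) (h y) (h z)) ->
  exists2 p, isolated (diag P) p & isolated (diag Q) (h p).
Proof.
move=> card_eq card_gt1 h_bij eq_curl; have [h' hK h'K] := h_bij.
have off_iso (V : finType) (R : poset V) p : p.1 != p.2 -> isolated (diag R) p.
  by move=> neq; apply/isolatedP => q; apply: weight_diag0.
pose off := [set p : T * T | p.1 != p.2].
pose dia (V : finType) := [set p : V * V | p.1 == p.2].
have card_dia (V : finType) : #|dia V| = #|V|.
  have -> : dia V = [set (x, x) | x in V].
    apply/setP => -[x y]; rewrite inE /=; apply/eqP/imsetP => [->|[z _ [-> ->]] //].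
    by exists y.
  by rewrite card_imset // => x y [].
have card_off : #|T| <= #|off|.
  have := cardsC (dia T); rewrite card_dia card_prod.
  have -> : ~: dia T = off by apply/setP => p; rewrite !inE.
  by nia.
case: (pickP [pred p | (p \in off) && ((h p).1 != (h p).2)]) => [p|none].
  by rewrite !inE => /andP[/off_iso iso_p /off_iso iso_hp]; exists p.
have imE : h @: off = dia U.
  apply/eqP; rewrite eqEcard card_dia card_imset; last exact: bij_inj.
  apply/andP; split; last by apply: leq_trans card_off; rewrite card_eq.
  apply/subsetP => _ /imsetP[p p_off ->]; rewrite inE.
  by have /negbT := none p; rewrite /= p_off negbK.
have [p0 p0_off] : exists p, p \in off.
  by apply/set0Pn; rewrite -card_gt0; apply: leq_trans card_off; apply: ltnW.
have [q0 q0_off] : exists q : U * U, q.1 != q.2.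
  have [x [y [_ _ neq]]] : exists x y : U, [/\ x \in U, y \in U & x != y].
    by apply/card_gt1P; rewrite -card_eq.
  by exists (x, y).
exists p0; first by apply: off_iso; rewrite inE in p0_off.
apply/isolatedP => q; case: (boolP (q.1 == q.2)) => [q_dia|q_off]; last first.
  by rewrite weightC weight_diag0 ?oppr0.
have /imsetP[p p_off ->] : q \in h @: off by rewrite imE inE.
have := eq_curl p0 p (h' q0); rewrite h'K /curl.
rewrite !inE in p_off p0_off.
have w0 := weight_diag0 P _ p0_off; have w1 := weight_diag0 P _ p_off.
have w2 := weight_diag0 Q _ q0_off.
rewrite (weightC _ p0 (h' q0)) (weightC _ q0 (h p)) !w0 !w1 !w2 !oppr0 !addr0.
by move=> ->.
Qed.

Lemma curl_diag (T U : finType) (P : poset T) (Q : poset U) :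
  poset_isomorphic P Q <-> curl_isomorphic (diag P) (diag Q).
Proof.
split=> [[f f_bij fE]|[h h_bij eq_curl]].
  have [g fK gK] := f_bij.
  exists (fun p => (f p.1, f p.2)).
    by exists (fun p => (g p.1, g p.2)) => -[x y] /=; rewrite ?fK ?gK.
  have relE p q : diag P p q = diag Q (f p.1, f p.2) (f q.1, f q.2).
    case: p q => [v x] [u y].
    by rewrite /= /diag_rel /= !xpair_eqE !(bij_eq f_bij) fE.
  by move=> x y z; rewrite /curl /weight !relE.
have card_eq : #|T| = #|U|.
  by apply/eqP; rewrite -eqn_sqr -!mulnn -!card_prod; apply/eqP/bij_eq_card/h_bij.
case: (leqP #|T| 1) => [T_le1|T_gt1].
  have U_le1 : #|U| <= 1 by rewrite -card_eq.
  pose f (x : T) := (h (x, x)).1.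
  have f_bij : bijective f.
    apply: inj_card_bij; last by rewrite card_eq.
    by move=> x y _; apply: (fintype_le1P T_le1).
  exists f => // x y.
  by rewrite (fintype_le1P T_le1 y x) !Defs.le_refl.
have [p /isolatedP p_iso /isolatedP hp_iso] :=
  isolated_to_isolated card_eq T_gt1 h_bij eq_curl.
apply: (diag_cancel card_eq h_bij) => x y.
have := eq_curl p x y; rewrite /curl (weightC _ p y) (weightC _ (h p) (h y)).
by rewrite !p_iso !hp_iso !oppr0 !addr0 !add0r.
Qed.

(** * The two reductions *)

Local Notation Not f := (Cond f (Const false) (Const true)).
Local Notation And f g := (Cond f g (Const false)).
Local Notation Or f g := (Cond f (Const true) g).
Local Notation Eq a b := (And (Le a b) (Le b a)).

Definition star_formula v x y :=
  let A z := Le z v in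
  let C z := And (Le v z) (Not (Eq z v)) in
  let B z := Not (Or (A z) (C z)) in
  let incomparable := And (Not (Le x y)) (Not (Le y x)) in
  Or (And (Or (And (A x) (A y)) (Or (And (B x) (B y)) (And (C x) (C y)))) (Le x y))
    (Or (And (B x) (And (A y) incomparable))
      (Or (And (C x) (A y)) (And (C x) (And (B y) incomparable)))).

Definition forest_formula := And (Eq 0 2) (star_formula 0 1 3).

Definition diag_formula :=
  Or (And (Eq 0 2) (Eq 1 3)) (And (Eq 0 1) (And (Eq 2 3) (Le 0 2))).

Lemma nat_le_eq (P : finite_poset) (x y : 'I_(fp_size P)) :
  nat_le P x y && nat_le P y x = (x == y).
Proof.
rewrite !nat_leE; apply/idP/eqP => [/(@Defs.le_anti _ P) //|->].
by rewrite Defs.le_refl.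
Qed.

Lemma if_bool_and (a b : bool) : (if a then b else false) = a && b.
Proof. by case: a. Qed.

Lemma if_bool_or (a b : bool) : (if a then true else b) = a || b.
Proof. by case: a. Qed.

Lemma if_bool_neg (a : bool) : (if a then false else true) = ~~ a.
Proof. by case: a. Qed.

Lemma forest_formulaE (P : finite_poset) v x u y :
  forest P (v, x) (u, y) = holds (nat_le P) (vars v x u y) forest_formula.
Proof.
rewrite /forest_formula /star_formula /= !(if_bool_and, if_bool_or, if_bool_neg).
rewrite /vars /upd /= !nat_le_eq !nat_leE /forest_rel /=.
by rewrite /rotation /incomp !inE.
Qed.

Lemma diag_formulaE (P : finite_poset) v x u y :
  diag P (v, x) (u, y) = holds (nat_le P) (vars v x u y) diag_formula.
Proof.
rewrite /diag_formula /= !(if_bool_and, if_bool_or, if_bool_neg).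
by rewrite /vars /upd /= !nat_le_eq !nat_leE.
Qed.

Theorem theorem3p17 :
  polytime_reducible rotation_isomorphism_problem poset_isomorphism_problem /\
  polytime_reducible poset_isomorphism_problem rotation_isomorphism_problem.
Proof.
split.
- exists (fun PQ => (square (forest (fp_order PQ.1)), square (forest (fp_order PQ.2)))).
    apply: (@interpretation_polytime forest_formula (fun P => forest P)) => // P v x u y.
    exact: forest_formulaE.
  move=> [P Q] /=; split.
    by move=> /curl_isomorphicP/curl_forest iso; apply/poset_isomorphic_pullback.
  by move=> /poset_isomorphic_pullback iso; apply/curl_isomorphicP/curl_forest.
- exists (fun PQ => (square (diag (fp_order PQ.1)), square (diag (fp_order PQ.2)))).
    apply: (@interpretation_polytime diag_formula (fun P => diag P)) => // P v x u y.
    exact: diag_formulaE.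
  move=> [P Q] /=; split.
    move=> /curl_diag iso; apply/curl_isomorphicP.
    exact/curl_isomorphic_pullback.
  move=> /curl_isomorphicP/curl_isomorphic_pullback iso.
  exact/curl_diag.
Qed.
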